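(* Let $n=2m$ for some integer $m\geq 2$, and let $t$ be a divisor of $n$. Let $G=D_{2n}=\langle a,b : a^n=b^2=e,\ b^{-1}ab=a^{-1}\rangle$ and let $H=\langle a^t\rangle$. Let $(\alpha,\beta)\neq(0,0)$ be a pair of non-negative integers. Then $H$ is an $(\alpha,\beta)$-regular set of $G$ if and only if one of the following occurs: (1) $t=2$ and $(\alpha,\beta)=(0,|H|)$; (2) $t=1$, $m$ is odd, $0\leq\alpha\leq|H|/2$ and $\beta\in\{0,|H|/2,|H|\}$; (3) $t=1$, $m$ is even, $\alpha=2\gamma$ for some integer $0\leq\gamma\leq|H|/4$, and $\beta\in\{0,|H|/2,|H|\}$; (4) $t>1$ and $m$ are both odd (i.e. $t>1$, $t$ odd, $m$ odd), $0\leq\alpha\leq|H|/2$ and $\beta\in\{0,|H|/2\}$; (5) $t>1$ is odd, $m$ is even, $\alpha=2\gamma$ for some integer $0\leq\gamma\leq|H|/4$, and $\beta\in\{0,|H|/2\}$.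
   Context: $D_{2n}$ is the dihedral group of order $2n$; divisors are positive. An element $x$ of a group $G$ is a square if $x=y^2$ for some $y\in G$. A subset of $G$ is square-free if none of its elements is a square of $G$; a subset $S$ is normal if $g^{-1}Sg=S$ for all $g\in G$. For a normal square-free subset $S$ of $G$ (possibly empty), the Cayley sum graph $\mathrm{CayS}(G,S)$ is the simple graph with vertex set $G$ in which $x,y$ are adjacent if and only if $xy\in S$. A set $C$ of vertices of a graph is an $(\alpha,\beta)$-regular set in the graph if every vertex in $C$ is adjacent to exactly $\alpha$ vertices of $C$ and every vertex not in $C$ is adjacent to exactly $\beta$ vertices of $C$. A subset $C\subseteq G$ is an $(\alpha,\beta)$-regular set of $G$ if it is an $(\alpha,\beta)$-regular set in $\mathrm{CayS}(G,S)$ for some normal square-free subset $S$ of $G$. *)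

(* Defs.v *)
From mathcomp Require Import all_boot all_fingroup all_solvable.

Set Implicit Arguments.
Unset Strict Implicit.
Unset Printing Implicit Defensive.

Local Open Scope group_scope.

Definition regular_set (T : finType) (V : {set T}) (e : rel T) (C : {set T})
    (alpha beta : nat) : Prop :=
  [/\ C \subset V,
      {in C, forall x, #|[set y in C | e x y]| = alpha} &
      {in V :\: C, forall x, #|[set y in C | e x y]| = beta}].

Section CayleySum.

Variable gT : finGroupType.
Implicit Types (G : {group gT}) (S C : {set gT}) (x y : gT).

Definition is_square G x : Prop := exists2 y, y \in G & x = y ^+ 2.

Definition square_free G S : Prop := {in S, forall x, ~ is_square G x}.

(* [normalised] only asserts S :^ g = S for g in G, where S :^ g = g^-1 S g;
   S is not required to be a subgroup. *)
Definition normal_square_free G S : Prop :=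
  [/\ S \subset G, {in G, normalised S} & square_free G S].

(* Adjacency relation of CayS(G, S), whose vertex set is G. *)
Definition cayley_sum G S : rel gT :=
  fun x y => [&& x \in G, y \in G & x * y \in S].

Lemma cayley_sum_sym G S :
  normal_square_free G S -> symmetric (cayley_sum G S).
Proof.
case=> _ nS _ x y; rewrite /cayley_sum andbCA; case Gy: (y \in G) => //=.
case Gx: (x \in G) => //=.
by rewrite -(memJ_conjg S x (x * y)) nS // conjgE -mulgA mulKg.
Qed.

Lemma cayley_sum_irr G S :
  normal_square_free G S -> irreflexive (cayley_sum G S).
Proof.
case=> _ _ sfS x; apply/negP => /and3P[Gx _ Sxx].
by apply: (sfS _ Sxx); exists x.
Qed.

Definition regular_set_of G C (alpha beta : nat) : Prop :=
  exists2 S, normal_square_free G S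
           & regular_set G (cayley_sum G S) C alpha beta.

End CayleySum.

(* Main.v *)
(** In G the squares are exactly the even powers of [a], so they form the subgroup
    K = <a^2>, of index 4.  A normal square-free S therefore consists of
    an inverse-closed set of odd powers of [a], together with some of the two
    reflection classes bK and baK; and x has #|xH :&: S| neighbours in H.
    If t is even, H lies in K, whence alpha = 0, and beta = 0 unless a^2 lies in
    H, i.e. t = 2.  If t is odd, every coset of H inside <a> is split in halves
    by K: each reflection class in S contributes #|H|/2 to beta, a coset aH <> H
    forces beta <= #|H|/2, and alpha is the size of an inverse-closed subset of
    H minus K, any such size being possible up to parity.  Since a^m is the only
    involution of <a>, parity is an obstruction exactly when m is even. *)

Require Import Defs.
From mathcomp Require Import all_boot all_fingroup all_solvable.
From mathcomp Require Import zify.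

(** * Inverse-closed subsets of a finite group *)

Section InverseClosed.

Local Open Scope group_scope.

Context {gT : finGroupType}.
Implicit Types P Q : {set gT}.

Definition inv_closed Q : Prop := {in Q, forall x, x^-1 \in Q}.

Lemma inv_closedV Q x : inv_closed Q -> (x^-1 \in Q) = (x \in Q).
Proof.
by move=> Qi; apply/idP/idP => [/Qi|/Qi //]; rewrite invgK.
Qed.

Lemma inv_closedD P Q : inv_closed P -> inv_closed Q -> inv_closed (P :\: Q).
Proof. by move=> Pi Qi x; rewrite !inE !inv_closedV. Qed.

Lemma inv_closedU P Q : inv_closed P -> inv_closed Q -> inv_closed (P :|: Q).
Proof. by move=> Pi Qi x; rewrite !inE !inv_closedV. Qed.

(** Pairs [x], [x^-1] are added one at a time: no element of [P] is self-inverse, so each pair has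
    two members, and since [Q] is inverse-closed, a pair with one member outside [Q] lies wholly
    outside it. *)
Lemma inv_closed_subset P k :
    inv_closed P -> {in P, forall x, x^-1 != x} -> 2 * k <= #|P| ->
  exists Q, [/\ Q \subset P, inv_closed Q & #|Q| = (2 * k)%N].
Proof.
move=> Pi Pn; elim: k => [|k IHk] leP.
  by exists set0; split; rewrite ?sub0set ?cards0 // => x; rewrite inE.
have [|Q [sQP Qi oQ]] := IHk; first by lia.
have /set0Pn[x xPQ] : P :\: Q != set0.
  by rewrite -card_gt0 cardsDS // oQ; lia.
have [/[!inE] /andP[nQx Px]] := (xPQ, Pn x).
move=> /(_ Px) x'Dx; exists (Q :|: [set x; x^-1]); split.
- by rewrite !subUset sQP !sub1set Px Pi.
- apply: inv_closedU => // y /set2P[] ->; rewrite ?invgK ?set21 ?set22 //.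
- rewrite cardsU (_ : Q :&: _ = set0) ?cards0 ?subn0; last first.
    apply/setP => y; rewrite !inE; apply/andP => -[Qy /pred2P[]] yE.
      by rewrite -yE Qy in nQx.
    by rewrite -(inv_closedV _ _ Qi) -yE Qy in nQx.
  by rewrite cards2 oQ eq_sym x'Dx; lia.
Qed.

(** Were the size odd, some inverse-closed subset would miss exactly one element of [P], and that
    element would be its own inverse. *)
Lemma inv_closed_even P :
  inv_closed P -> {in P, forall x, x^-1 != x} -> ~~ odd #|P|.
Proof.
move=> Pi Pn; apply/negP => oddP.
have [|Q [sQP Qi oQ]] := inv_closed_subset P (#|P| %/ 2) Pi Pn; first by lia.
have /cards1P[x PQE] : #|P :\: Q| == 1%N by rewrite cardsDS // oQ; lia.
have PQx : x \in P :\: Q by rewrite PQE set11.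
have := inv_closedD P Q Pi Qi x PQx; rewrite {1}PQE => /set1P /eqP.
by apply/negP/Pn; case/setDP: PQx.
Qed.

End InverseClosed.

(** * Rotations, reflections and squares in the dihedral group *)

Section Dihedral.

Local Open Scope group_scope.

Variables (gT : finGroupType) (a b : gT) (m t : nat).
Hypotheses (oa : #[a] = (2 * m)%N) (b2 : b * b = 1) (ab : b * a * b = a^-1)
  (bA : b \notin <[a]>) (t_dvd : t %| #[a]).

Let A : {set gT} := <[a]>.
Let K : {set gT} := <[a ^+ 2]>.
Let H : {set gT} := <[a ^+ t]>.
Let G : {set gT} := <<[set a; b]>>.

(** Exponents matter only modulo [#[a]], and divisibility by [d] survives this reduction because [d]
    divides [#[a]]. *)
Lemma mem_cycleX i d : d %| #[a] -> (a ^+ i \in <[a ^+ d]>) = (d %| i).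
Proof.
move=> d_dvd; apply/cycleP/dvdnP => [[j]|[j ->]]; last first.
  by exists j; rewrite mulnC expgM.
rewrite -expgM => /eqP; rewrite eq_expg_mod_order => /eqP ij.
apply/dvdnP; rewrite /dvdn -(modn_dvdm _ d_dvd) ij modn_dvdm //.
by rewrite modnMr.
Qed.

Lemma expg_mem_sq i : (a ^+ i \in K) = ~~ odd i.
Proof. by rewrite /K mem_cycleX ?dvdn2 ?oa ?oddM. Qed.

Lemma sq_rot : {subset K <= A}.
Proof. by apply/subsetP; rewrite cycle_subG groupX ?cycle_id. Qed.

Lemma subgroup_rot : {subset H <= A}.
Proof. by apply/subsetP; rewrite cycle_subG groupX ?cycle_id. Qed.

Lemma b_inv : b^-1 = b.
Proof. by apply/eqP; rewrite eq_invg_mul b2. Qed.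

Lemma bK : involutive (mulg b).
Proof. by move=> x; rewrite mulgA b2 mul1g. Qed.

Lemma conj_b x : x \in A -> b * x * b = x^-1.
Proof.
case/cycleP => i ->; rewrite -{1}b_inv -mulgA -conjgE conjXg conjgE mulgA b_inv ab.
by rewrite expgVn.
Qed.

Lemma b_mul x : x \in A -> b * x = x^-1 * b.
Proof. by move=> Ax; rewrite -(conj_b _ Ax) -mulgA b2 mulg1. Qed.

(** Conjugation by [b] inverts [a], so [b] normalises [A] and the group is the product of [A] and
    [<[b]>]. *)
Lemma mem_dihedral x : (x \in G) = (x \in A) || (b * x \in A).
Proof.
have Ga : a \in G by rewrite mem_gen ?set21.
have Gb : b \in G by rewrite mem_gen ?set22.
have AG y : y \in A -> y \in G by apply/subsetP: y; rewrite cycle_subG.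
apply/idP/orP => [|[/AG //|/AG Gbx]]; last by rewrite -(bK x) groupM.
have nAb : <[b]> \subset 'N(A).
  by rewrite cycle_subG inE -cycleJ conjgE b_inv mulgA ab cycleV.
have -> : G = <[a]> <*> <[b]> by rewrite joing_idl joing_idr.
rewrite norm_joinEr // => /mulsgP[y c Ay /cycleP[i ->] ->].
have ->: b ^+ i = b ^+ odd i.
  by rewrite -{1}(odd_double_half i) expgD -mul2n expgM expg2 b2 expg1n mulg1.
case: (odd i); rewrite ?mulg1; last by left.
by right; rewrite mulgA conj_b // groupV.
Qed.

Lemma sq_dihedral x : x \in G -> x ^+ 2 \in K.
Proof.
rewrite mem_dihedral expgS expg1 => /orP[/cycleP[i ->]|Abx].
  by rewrite -expgD addnn expg_mem_sq odd_double.
by rewrite -(bK x) mulgA conj_b // mulVg group1.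
Qed.

Lemma sq_mulg w y : w \in A -> y \in A -> (w * y \in K) = ((w \in K) == (y \in K)).
Proof.
case/cycleP => i -> /cycleP[j ->].
by rewrite -expgD !expg_mem_sq oddD; case: (odd i); case: (odd j).
Qed.

Lemma gen_subgroup_nsq : odd t -> a ^+ t \notin K.
Proof. by rewrite expg_mem_sq negbK. Qed.

Lemma subgroup_sq : ~~ odd t -> {subset H <= K}.
Proof. by move=> te; apply/subsetP; rewrite cycle_subG expg_mem_sq. Qed.

(** For odd [t], left translation by [a ^+ t], an element of [H] outside [K], exchanges the two
    sets. *)
Lemma card_coset_nsq z : odd t -> z \in A ->
  #|[set y in H | z * y \notin K]| = #|[set y in H | z * y \in K]|.
Proof.
move=> to Az; rewrite -(card_lcoset _ (a ^+ t)).
apply: eq_card => y; rewrite mem_lcoset !inE groupMl ?groupV ?cycle_id //.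
case Hy: (y \in H) => //=; have Ay := subgroup_rot _ Hy.
have At : a ^+ t \in A := mem_cycle a t.
rewrite !sq_mulg ?groupM ?groupV //.
by rewrite (negbTE (gen_subgroup_nsq to)); case: (z \in K); case: (y \in K).
Qed.

Lemma card_coset_sq z : odd t -> z \in A ->
  #|H| = (2 * #|[set y in H | (z * y)%g \in K]|)%N.
Proof.
move=> to Az; rewrite -(cardsID [set y | z * y \in K] H) mul2n -addnn.
congr (_ + _)%N; first by apply: eq_card => y; rewrite !inE.
by rewrite -card_coset_nsq //; apply: eq_card => y; rewrite !inE andbC.
Qed.

Lemma card_subgroup_nsq : odd t -> #|H| = (2 * #|H :\: K|)%N.
Proof.
move=> to; rewrite (card_coset_sq 1 to) ?group1 // -card_coset_nsq ?group1 //.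
by congr (2 * _)%N; apply: eq_card => y; rewrite !inE mul1g andbC.
Qed.

Lemma dvdn_half : odd t -> t %| m.
Proof. by move=> to; move: t_dvd; rewrite oa Gauss_dvdr // coprimen2. Qed.

(** Write [x = a ^+ i] with [i] odd. Being self-inverse makes [i] a multiple of [m], so [m] and the
    cofactor are both odd, and [i] is congruent to [m] modulo [2 * m]. *)
Lemma nsq_involution x : x \in A -> x \notin K -> x^-1 = x -> odd m /\ x = a ^+ m.
Proof.
case/cycleP => i -> oi /eqP; rewrite eq_invg_mul -expgD -order_dvdn oa.
rewrite expg_mem_sq negbK in oi; rewrite addnn -mul2n dvdn_pmul2l // => /dvdnP[j ij].
move: oi; rewrite ij oddM => /andP[oj om]; split=> //.
apply/eqP; rewrite eq_expg_mod_order oa -(odd_double_half j) oj mulnDl mul1n.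
by rewrite addnC -muln2 -mulnA modnMDl.
Qed.

Lemma inv_closed_group (L : {group gT}) : inv_closed L.
Proof. by move=> x; rewrite groupV. Qed.

Lemma nsq_inv_neq x : odd m = false -> x \in H :\: K -> x^-1 != x.
Proof.
move=> em /setDP[/subgroup_rot Ax nKx]; apply/eqP => /(nsq_involution x Ax nKx)[].
by rewrite em.
Qed.

(** For odd [m] the only self-inverse element of [H :\: K] is [a ^+ m]; the rest splits into pairs,
    and [a ^+ m] is put back exactly when [k] is odd. For even [m] pairs alone suffice. *)
Lemma exists_inv_closed k : odd t -> k <= #|H :\: K| -> (odd k -> odd m) ->
  exists Q : {set gT}, [/\ Q \subset H :\: K, inv_closed Q & #|Q| = k].
Proof.
move=> to le_k km.
have Pi : inv_closed (H :\: K) by apply: inv_closedD; apply: inv_closed_group.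
case om: (odd m); last first.
  have ek : ~~ odd k by apply/negP => /km; rewrite om.
  have [||Q [sQ Qi oQ]] := inv_closed_subset (H :\: K) (k %/ 2) Pi.
  - by move=> x; apply: nsq_inv_neq.
  - by lia.
  by exists Q; split=> //; lia.
set z := a ^+ m.
have z_inv : z^-1 = z by apply/eqP; rewrite eq_invg_mul -expgD addnn -mul2n -oa expg_order.
(* An odd divisor [t] of [2 * m] divides [m], which puts [a ^+ m] in [H]. *)
have Pz : z \in H :\: K by rewrite inE expg_mem_sq om /= mem_cycleX ?dvdn_half.
have zi : inv_closed [set z] by move=> x /set1P ->; rewrite z_inv set11.
have P'i := inv_closedD _ _ Pi zi.
have P'n : {in (H :\: K) :\ z, forall x, x^-1 != x}.
  move=> x /setD1P[xz /setDP[/subgroup_rot Ax nKx]]; apply: contra xz => /eqP.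
  by case/(nsq_involution x Ax nKx) => _ ->.
have oP : #|H :\: K| = #|(H :\: K) :\ z|.+1 by rewrite (cardsD1 z) Pz.
have eP := inv_closed_even _ P'i P'n.
have [|Q [sQ Qi oQ]] := inv_closed_subset _ (k %/ 2) P'i P'n; first by lia.
have [sQP nQz] : Q \subset H :\: K /\ z \notin Q by apply/andP; rewrite -subsetD1.
case ok: (odd k); last by exists Q; split=> //; lia.
exists (z |: Q); split; first by rewrite subUset sub1set Pz.
  exact: inv_closedU.
by rewrite cardsU1 nQz oQ; lia.
Qed.

(** Conjugation by [a ^+ j] sends [b * v] to [b * v * a ^+ (2 * j)], so a normal set contains all or
    nothing of each reflection class. *)
Lemma mem_normal_nonrot S w : {in G, normalised S} -> w \in A ->
  (b * w \in S) = if w \in K then b \in S else b * a \in S.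
Proof.
move=> nS.
have shift v j : v \in A -> (b * v * a ^+ (2 * j) \in S) = (b * v \in S).
  move=> Av; have Aj : a ^+ j \in A by apply: mem_cycle.
  rewrite -(memJ_conjg S (a ^+ j) (b * v)) nS ?mem_dihedral ?Aj //.
  rewrite conjgE [in RHS]mulgA [in RHS]mulgA -b_mul // mul2n -addnn expgD !mulgA.
  congr (_ * _ \in S); rewrite -!mulgA; congr (b * _).
  by apply: (centsP (cycle_abelian a)).
case/cycleP => i ->; rewrite expg_mem_sq -{1}(odd_double_half i) -mul2n.
case: (odd i) => /=; first by rewrite add1n expgS mulgA shift ?cycle_id.
by rewrite add0n -[in LHS](mulg1 b) shift ?group1 ?mulg1.
Qed.

(** The rotation [b * x] translates [H] to a coset halved by [K], so half of [x * H] falls in each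
    reflection class. *)
Lemma card_nonrot_coset S x : odd t -> {in G, normalised S} ->
    x \in G -> x \notin A ->
  #|[set y in H | x * y \in S]| =
    (((b \in S) + ((b * a)%g \in S)) * (#|H| %/ 2))%N.
Proof.
move=> to nS Gx nAx.
have Abx : b * x \in A by move: Gx; rewrite mem_dihedral (negbTE nAx).
have oE := card_coset_sq _ to Abx; have oO := card_coset_nsq _ to Abx.
have E y : y \in H -> (x * y \in S) =
    if b * x * y \in K then b \in S else b * a \in S.
  move=> Hy; have Abxy : b * x * y \in A by rewrite groupM // subgroup_rot.
  by rewrite -(mem_normal_nonrot _ _ nS Abxy) -[b * x * y]mulgA bK.
have -> : [set y in H | x * y \in S] =
    [set y in H | if b * x * y \in K then b \in S else b * a \in S].
  by apply/setP => y; rewrite !inE; case Hy: (y \in H) => //=; rewrite E.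
rewrite oE mulKn //; case: (b \in S); case: (b * a \in S) => /=.
- rewrite (_ : [set y in H | _] = H); first by rewrite oE.
  by apply/setP => y; rewrite !inE; case: ifP; rewrite andbT.
- rewrite (_ : [set y in H | _] = [set y in H | b * x * y \in K]); first by rewrite mul1n.
  by apply/setP => y; rewrite !inE; case: ifP.
- rewrite (_ : [set y in H | _] = [set y in H | b * x * y \notin K]); first by rewrite mul1n.
  by apply/setP => y; rewrite !inE; case: ifP.
- rewrite (_ : [set y in H | _] = set0) ?cards0 //.
  by apply/setP => y; rewrite !inE; case: ifP; rewrite andbF.
Qed.

(** * Neighbourhoods in [H] and connection sets *)

Let Gg : {group gT} := <<[set a; b]>>%G.

Lemma nbhd_cayley_sum (S : {set gT}) x : x \in G ->
  [set y in H | cayley_sum Gg S x y] = [set y in H | x * y \in S].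
Proof.
move=> Gx; apply/setP => y; rewrite !inE /cayley_sum Gx /=.
by case Hy: (y \in H); rewrite //= mem_dihedral subgroup_rot.
Qed.

Lemma card_subgroup_coset (S : {set gT}) x : x \in H ->
  #|[set y in H | x * y \in S]| = #|H :&: S|.
Proof.
move=> Hx; rewrite -(card_lcoset [set y in H | _] x); apply: eq_card => y.
by rewrite mem_lcoset !inE mulKVg groupMl ?groupV.
Qed.

(** Left translation by a vertex of [H] preserves [H], so all these vertices have equally many
    neighbours in [H], and one equation covers the condition on [alpha]. *)
Lemma regular_setE (S : {set gT}) alpha beta :
  regular_set Gg (cayley_sum Gg S) H alpha beta <->
    #|H :&: S| = alpha /\
    {in G :\: H, forall x, #|[set y in H | x * y \in S]| = beta}.
Proof.
have HG x : x \in H -> x \in G by move=> Hx; rewrite mem_dihedral subgroup_rot.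
split=> [[_ oa' ob]|[oa' ob]].
  split=> [|x GHx]; last by rewrite -(ob x GHx) nbhd_cayley_sum //; case/setDP: GHx.
  by rewrite -(oa' 1) ?group1 // nbhd_cayley_sum ?HG // card_subgroup_coset.
split=> [|x Hx|x GHx]; first by apply/subsetP.
  by rewrite nbhd_cayley_sum ?HG // card_subgroup_coset.
by rewrite -(ob x GHx) nbhd_cayley_sum //; case/setDP: GHx.
Qed.

Lemma square_free_nsq (S : {set gT}) x : square_free Gg S -> x \in S -> x \notin K.
Proof.
move=> sfS Sx; apply/negP => /cycleP[j xE]; apply: (sfS x Sx).
exists (a ^+ j); first by rewrite groupX // mem_gen ?set21.
by rewrite xE -!expgM mulnC.
Qed.

Lemma normalised_gen (S : {set gT}) :
  (forall x, x \in S -> x ^ a \in S) -> (forall x, x \in S -> x ^ b \in S) ->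
  {in Gg, normalised S}.
Proof.
move=> Sa Sb; apply/normsP; rewrite gen_subG subUset !sub1set !inE.
by apply/andP; split; apply/subsetP => _ /imsetP[x Sx ->]; auto.
Qed.

(* [Q] is the part of the connection set in H, [c] tells whether it contains the
   odd powers of [a] outside H, and [s0], [s1] whether it contains bK and baK. *)
Definition connection_set (Q : {set gT}) (c s0 s1 : bool) : {set gT} :=
  [set x in G | if x \in A then (x \notin K) && (if x \in H then x \in Q else c)
                else if b * x \in K then s0 else s1].

Lemma connection_set_normal Q c s0 s1 : inv_closed Q ->
  normal_square_free Gg (connection_set Q c s0 s1).
Proof.
move=> Qi; split.
- by apply/subsetP => x; rewrite inE => /andP[].
- have Aa : a \in A := cycle_id a.
  have Ga : a \in G by rewrite mem_gen ?set21.
  have Gb : b \in G by rewrite mem_gen ?set22.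
  have bA' y : y \in A -> (b * y \in A) = false.
    by move=> Ay; rewrite groupMr // (negbTE bA).
  apply: normalised_gen => x; rewrite !inE => /andP[Gx]; rewrite groupJ //=.
    have [Ax|nAx] := boolP (x \in A).
      have ->: x ^ a = x by apply/conjg_fixP/commgP/(centsP (cycle_abelian a)).
      by rewrite Ax.
    have Aw : b * x \in A by move: Gx; rewrite mem_dihedral (negbTE nAx).
    (* Conjugation by [a] multiplies a reflection by [a ^+ 2], an element of [K], so its class is
       kept. *)
    have ->: x ^ a = b * (b * x * a ^+ 2).
      have axC : a * (b * x) = b * x * a by apply: (centsP (cycle_abelian a)).
      rewrite conjgE -{1}(bK x) !mulgA -b_mul //.
      by rewrite -[b * a * b * x]mulgA -[b * a * _]mulgA axC !mulgA.
    have Awa : b * x * a ^+ 2 \in A by apply: groupM => //; apply: groupX.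
    by rewrite (bA' _ Awa) bK [_ * a ^+ 2 \in K]groupMr ?cycle_id.
  have [Ax|nAx] := boolP (x \in A).
    by rewrite conjgE b_inv mulgA conj_b // !groupV Ax inv_closedV.
  have Aw : b * x \in A by move: Gx; rewrite mem_dihedral (negbTE nAx).
  (* Conjugation by [b] inverts the rotation part, which does not affect membership in [K]. *)
  have ->: x ^ b = b * (b * x)^-1.
    by rewrite b_mul ?groupV // invgK conjgE b_inv mulgA.
  have Awi : (b * x)^-1 \in A by rewrite groupV.
  by rewrite (bA' _ Awi) bK groupV.
- move=> x; rewrite inE => /andP[_ Sx] [y Gy xE].
  have Kx : x \in K by rewrite xE sq_dihedral.
  by move: Sx; rewrite sq_rot // Kx.
Qed.

(** * Regular sets according to the parity of [t] *)

Lemma b_notin_subgroup : b \in G :\: H.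
Proof. by rewrite inE (mem_gen (set22 a b)) (contra (subgroup_rot b)). Qed.

(** This merges the four cases with [t] odd: [s0 + s1] counts the reflection classes in the
    connection set, each contributing [k] to [beta]. *)
Lemma regular_set_of_odd k alpha beta : odd t -> #|H| = (2 * k)%N ->
  regular_set_of Gg H alpha beta <->
    [/\ alpha <= k, odd alpha -> odd m
      & exists s0 s1 : bool, beta = ((s0 + s1) * k)%N /\ (1 < t -> s0 + s1 <= 1)].
Proof.
move=> to oH; have h2 : #|H| %/ 2 = k by rewrite oH mulKn.
have nsq : #|H :\: K| = k by rewrite -h2 (card_subgroup_nsq to) mulKn.
split=> [[S [sSG nS sfS] /regular_setE[<- oS]]|[le_a odd_a [s0 [s1 [-> s01]]]]].
  have sHS : H :&: S \subset H :\: K.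
    by apply/subsetP => x /setIP[Hx Sx]; rewrite inE (square_free_nsq S).
  split; first by rewrite -nsq subset_leq_card.
    (* For even [m] no element of [H :&: S] is self-inverse; the set is inverse-closed because
       conjugation by [b] inverts rotations. *)
    apply: contraLR => om; apply: inv_closed_even => [x /setIP[Hx Sx]|x Px].
      rewrite inE groupV Hx /=.
      have Ax : x \in A by apply: subgroup_rot.
      by rewrite -(conj_b _ Ax) -mulgA -{1}b_inv -conjgE -(nS b) ?memJ_conjg ?mem_gen ?set22.
    by apply: nsq_inv_neq (subsetP sHS x Px); apply: negbTE.
  exists (b \in S), (b * a \in S); split.
    by rewrite -(oS b b_notin_subgroup) -h2 card_nonrot_coset // mem_gen ?set22.
  (* Now [a] and [b] both lie outside [H], so they have equally many neighbours in [H]: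
     [(s0 + s1) * k] for [b], but at most [k] for [a], since only the half of its coset outside [K]
     can meet [S]. *)
  move=> t1.
  have aH : a \in G :\: H.
    rewrite inE (mem_gen (set21 a b)) andbT.
    by rewrite -[a]expg1 mem_cycleX // dvdn1 gtn_eqF.
  rewrite -(@leq_pmul2r k); last first.
    by rewrite -(ltn_pmul2l (isT : 0 < 2)) -oH cardG_gt0.
  have := card_nonrot_coset S b to nS (mem_gen (set22 a b)) bA.
  rewrite h2 (oS b b_notin_subgroup) => <-; rewrite -(oS a aH) mul1n -h2.
  rewrite (card_coset_sq a) ?cycle_id // mulKn // -card_coset_nsq ?cycle_id //.
  apply/subset_leq_card/subsetP => y; rewrite !inE => /andP[-> Say] /=.
  exact: square_free_nsq Say.
rewrite -nsq in le_a; have [Q [sQ Qi oQ]] := exists_inv_closed alpha to le_a odd_a.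
(* A rotation outside [H] exists only for [t > 1], where [s0 + s1 <= 1]; it must then have [k]
   neighbours in [H] precisely when one of the two classes is present. *)
pose c := s0 || s1.
exists (connection_set Q c s0 s1); first exact: connection_set_normal.
have [_ nS _] := connection_set_normal Q c s0 s1 Qi.
apply/regular_setE; split.
  rewrite -oQ; apply: eq_card => x; rewrite !inE.
  have [Hx|nHx] := boolP (x \in H); last first.
    by apply/esym/(contraNF _ nHx) => /(subsetP sQ)/setDP[].
  rewrite mem_dihedral subgroup_rot //=.
  apply: andb_idl => /(subsetP sQ); by rewrite inE Hx andbT.
move=> x /setDP[Gx nHx].
have [Ax|nAx] := boolP (x \in A); last first.
  rewrite card_nonrot_coset // h2; congr (_ * _)%N.
  have Gb : b \in G by rewrite mem_gen ?set22.
  have Ga : a \in G by rewrite mem_gen ?set21.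
  have baA : (b * a \in A) = false by rewrite groupMr ?cycle_id // (negbTE bA).
  have aK : (a \in K) = false by rewrite -[a]expg1 expg_mem_sq.
  by rewrite !inE Gb (groupM Gb Ga) (negbTE bA) baA bK b2 aK group1.
have t1 : 1 < t.
  rewrite ltn_neqAle eq_sym odd_gt0 // andbT.
  by apply: contraNneq nHx => t1; rewrite /H t1 expg1.
have E y : y \in H -> (x * y \in connection_set Q c s0 s1) = c && (x * y \notin K).
  move=> Hy; have Axy : x * y \in A by rewrite groupM // subgroup_rot.
  by rewrite inE mem_dihedral Axy /= [x * y \in H]groupMr // (negbTE nHx) andbC.
have -> : [set y in H | x * y \in connection_set Q c s0 s1] =
    if c then [set y in H | x * y \notin K] else set0.
  apply/setP => y; rewrite inE; case Hy: (y \in H) => /=.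
    by rewrite E //; case: (c) => /=; rewrite !inE ?Hy.
  by case: (c); rewrite !inE ?Hy.
have := s01 t1; rewrite /c -h2; case: (s0); case: (s1) => //= _;
by rewrite ?cards0 // ?addn0 ?add0n mul1n card_coset_nsq // (card_coset_sq x) // mulKn.
Qed.

Lemma regular_set_of_even alpha beta : ~~ odd t -> (alpha, beta) <> (0, 0) ->
  regular_set_of Gg H alpha beta <-> [/\ t = 2, alpha = 0 & beta = #|H|].
Proof.
move=> te ne; split=> [[S [sSG nS sfS] /regular_setE[oS0 oS]]|[t2 -> ->]].
  have HK := subgroup_sq te.
  have a0 : alpha = 0.
    rewrite -oS0; apply/eqP; rewrite cards_eq0; apply/eqP/setP => x; rewrite !inE.
    by apply/andP => -[/HK Kx /(square_free_nsq S x sfS)]; rewrite Kx.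
  have t2 : t = 2.
    apply/eqP; apply: contraT => nt2; case: ne; congr (_, _) => //.
    (* For even [t], [a ^+ 2] lies in [H] only if [t = 2]. Otherwise its coset of [H] lies in [K],
       avoids [S], and forces [beta = 0]. *)
    have a2 : a ^+ 2 \in G :\: H.
      have Ga2 : a ^+ 2 \in G by rewrite groupX // mem_gen ?set21.
      rewrite inE Ga2 andbT mem_cycleX //.
      by rewrite dvdn_divisors // !inE negb_or nt2 andbT; apply: contraNneq te => ->.
    rewrite -(oS _ a2); apply/eqP; rewrite cards_eq0; apply/eqP/setP => y; rewrite !inE.
    apply/andP => -[/HK Ky /(square_free_nsq S _ sfS)].
    by rewrite groupM ?cycle_id.
  split=> //; have := oS b b_notin_subgroup.
  (* As [H] lies in [K], the coset of [b] stays in one reflection class, so [b] is adjacent to all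
     of [H] or to none of it. *)
  have E y : y \in H -> (b * y \in S) = (b \in S).
    by move=> Hy; rewrite (mem_normal_nonrot S y nS) ?subgroup_rot // HK.
  case bS: (b \in S) => <-.
    by apply: eq_card => y; rewrite inE; case Hy: (y \in H); rewrite //= E.
  case: ne; rewrite a0 -(oS b b_notin_subgroup); congr (_, _).
  apply/eqP; rewrite cards_eq0; apply/eqP/setP => y; rewrite !inE.
  by case Hy: (y \in H); rewrite //= E.
have Qi : inv_closed (set0 : {set gT}) by move=> x; rewrite inE.
(* For [t = 2] the subgroups [H] and [K] coincide, and this is the whole complement of [H]. *)
exists (connection_set set0 true true true); first exact: connection_set_normal.
have E x : (x \in connection_set set0 true true true) = (x \in G :\: H).
  have KH : (x \in K) = (x \in H) by rewrite /H t2.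
  rewrite !inE KH andbC; case Hx: (x \in H); first by rewrite subgroup_rot.
  by rewrite /= !if_same.
apply/regular_setE; split.
  apply/eqP; rewrite cards_eq0; apply/eqP/setP => x; rewrite inE E !inE.
  by case: (x \in H).
move=> x /setDP[Gx nHx]; apply: eq_card => y; rewrite inE E !inE.
case Hy: (y \in H) => //=.
by rewrite groupMr // nHx groupM // mem_dihedral subgroup_rot.
Qed.

End Dihedral.

(** * Orders of the generators, and assembly of the five cases *)

Theorem theorem3p8 (m n t : nat) (hm : 2 <= m) (hn : n = 2 * m) (ht : t %| n)
    (gT : finGroupType) (G : {group gT}) (a b : gT)
    (hG : (G \isog 'D_(2 * n))%g)
    (hab : (<<[set a; b]>> = G :> {set gT})%g)
    (han : (a ^+ n = 1)%g) (hb2 : (b ^+ 2 = 1)%g)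
    (hrel : (b^-1 * a * b = a^-1)%g)
    (H : {group gT}) (hH : (H = <[a ^+ t]> :> {set gT})%g)
    (alpha beta : nat) (hne : (alpha, beta) <> (0, 0)) :
  regular_set_of G H alpha beta <->
     [/\ t = 2, alpha = 0 & beta = #|H|]
  \/ [/\ t = 1, odd m, alpha <= #|H| %/ 2
       & beta \in [:: 0; #|H| %/ 2; #|H|]]
  \/ [/\ t = 1, ~~ odd m,
         exists2 gamma, gamma <= #|H| %/ 4 & alpha = 2 * gamma
       & beta \in [:: 0; #|H| %/ 2; #|H|]]
  \/ [/\ 1 < t /\ odd t, odd m, alpha <= #|H| %/ 2
       & beta \in [:: 0; #|H| %/ 2]]
  \/ [/\ 1 < t /\ odd t, ~~ odd m,
         exists2 gamma, gamma <= #|H| %/ 4 & alpha = 2 * gamma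
       & beta \in [:: 0; #|H| %/ 2]].
Proof.
have b2 : (b * b = 1)%g by rewrite -expg2.
have bV : (b^-1 = b)%g by apply/eqP; rewrite eq_invg_mul b2.
have ab : (b * a * b = a^-1)%g by rewrite -{1}bV.
have oG : #|G| = 2 * n by rewrite (card_isog hG) mul2n card_dihedral //; lia.
have GE : (<[a]> * <[b]>)%g = G.
  rewrite -norm_joinEr; first by rewrite joing_idl joing_idr; exact: hab.
  by rewrite cycle_subG inE -cycleJ conjgE mulgA hrel cycleV.
have n_gt0 : 0 < n by lia.
have le_a : #[a]%g <= n by rewrite dvdn_leq ?order_dvdn ?han.
have le_b : #[b]%g <= 2 by rewrite dvdn_leq ?order_dvdn ?hb2.
(* The product of the two cyclic groups has [2 * n] elements, and [b] has order at most 2, which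
   leaves at least [n] for the order of [a]. *)
have oa : #[a]%g = n.
  apply/eqP; rewrite eqn_leq le_a -(leq_pmul2l (isT : 0 < 2)) -oG -GE.
  have := mul_cardG <[a]> <[b]>; rewrite -!orderE => oab.
  apply: (@leq_trans (#[a]%g * #[b]%g)); last by rewrite mulnC leq_mul.
  by rewrite oab leq_pmulr // cardG_gt0.
have bA : b \notin <[a]>%g.
  apply/negP => Ab; have: #|G| <= #[a]%g; last by lia.
  by rewrite orderE subset_leq_card // -GE mul_subG // cycle_subG.
have {}GE : G = <<[set a; b]>>%G by apply: val_inj.
have {}hH : H = <[(a ^+ t)%g]>%G by apply: val_inj.
rewrite -oa in ht; rewrite hn in oa.
have oH : #|H| * t = 2 * m.
  by rewrite hH /= -orderE orderXdiv // oa divnK // -oa.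
have regE : regular_set_of G H alpha beta <->
  regular_set_of <<[set a; b]>>%G <[(a ^+ t)%g]>%g alpha beta by rewrite GE hH.
rewrite regE; have [to|te] := boolP (odd t); last first.
  rewrite regular_set_of_even //; try exact: oa.
  rewrite -[#|<[_]>%g|]/(#|<[_]>%G|) -hH.
  split=> [|[//|[[t1]|[[t1]|[[[_ //]]|[[_ //]]]]]]]; first by left.
  - by rewrite t1 in te.
  - by rewrite t1 in te.
have [k oHk] : exists k, #|H| = 2 * k.
  exists (#|H| %/ 2); have: ~~ odd (#|H| * t) by rewrite oH oddM.
  by rewrite oddM to andbT; lia.
have k_gt0 : 0 < k by rewrite -(ltn_pmul2l (isT : 0 < 2)) -oHk cardG_gt0.
rewrite (regular_set_of_odd _ _ _ _ _ oa _ _ _ _ k) //; last by rewrite -oHk hH.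
rewrite !oHk mulKn //.
(* The rounded bound on [gamma] thus says exactly that [alpha = 2 * gamma] is at most [k]. *)
have h4 j : j <= 2 * k %/ 4 <-> 2 * j <= k by lia.
rewrite !inE; split.
  case=> le_al odd_a [s0 [s1 [betaE s01]]].
  have betaP : [|| beta == 0, beta == k | beta == 2 * k].
    by move: betaE; case: (s0); case: (s1) => /= ->; lia.
  have [t1|t_neq1] := eqVneq t 1.
    right; case om: (odd m) odd_a => odd_a; first by left.
    right; left; split=> //; exists (alpha %/ 2); lia.
  have t_gt1 : 1 < t by rewrite ltn_neqAle eq_sym t_neq1 odd_gt0.
  have {}betaP : (beta == 0) || (beta == k).
    by move: betaE (s01 t_gt1); case: (s0); case: (s1) => //= ->; lia.
  do 3!right; case om: (odd m) odd_a => odd_a; first by left.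
  right; split=> //; exists (alpha %/ 2); lia.
have bool_witness u : beta = u * k -> u <= 2 -> (1 < t -> u <= 1) ->
    exists s0 s1 : bool,
      beta = (s0 + s1) * k /\ (1 < t -> s0 + s1 <= 1).
  by case: u => [|[|[|]]] // -> _ u1;
    [exists false, false | exists true, false | exists true, true].
have witness1 : t = 1 -> [|| beta == 0, beta == k | beta == 2 * k] ->
    exists s0 s1 : bool,
      beta = (s0 + s1) * k /\ (1 < t -> s0 + s1 <= 1).
  move=> t1 /or3P[] /eqP betaE; [apply: (bool_witness 0) | apply: (bool_witness 1)
    | apply: (bool_witness 2)]; by rewrite ?t1 // betaE ?mul1n.
(* Here [t_gt1] is an arbitrary premise, later instantiated by [1 < t]: at most one reflection class
   is taken. *)
have witness t_gt1 : (beta == 0) || (beta == k) ->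
    exists s0 s1 : bool,
      beta = (s0 + s1) * k /\ (t_gt1 -> s0 + s1 <= 1).
  case/orP=> /eqP ->; [exists false, false | exists true, false] => //.
  by rewrite mul1n.
case=> [[t2]|[[t1 om le_al bP]|[[t1 _ [j /h4 le_k ->] bP]
  |[[_ om le_al bP]|[_ _ [j /h4 le_k ->] bP]]]]].
- by rewrite t2 in to.
- by split=> //; apply: witness1.
- by split=> //; [rewrite oddM | apply: witness1].
- by split=> //; apply: witness.
- by split=> //; [rewrite oddM | apply: witness].
Qed.
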